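(* Let $\mathrm{tw}^t$ be a twist automorphism on $\mathcal F(t)$ for some quantum seed $t\in\Delta^+$. Then for any seed $s=\overleftarrow\mu_{s,t}\,t\in\Delta^+$, the map $\mathrm{tw}^s=(\mu_{s,t}^* )^{-1}\,\mathrm{tw}^t\,\mu_{s,t}^*$ is a twist automorphism on $\mathcal F(s)$, where $\mu^*_{s,t}:\mathcal F(s)\cong\mathcal F(t)$ is the mutation isomorphism.
   Context: **Quantum seeds.** $\Bbbk=\mathbb Z[q^{\pm1/2}]$, $v=q^{1/2}$, $[x]_+=\max(x,0)$. $I=I_{uf}\sqcup I_f$ is a finite set (unfrozen/frozen vertices). A quantum seed $t$ consists of an integer matrix $\tilde B(t)=(b_{ij})_{i\in I,j\in I_{uf}}$ of full rank $|I_{uf}|$ whose square part $B(t)=(b_{ij})_{i,j\in I_{uf}}$ is skew-symmetrizable, a skew-symmetric integer matrix $\Lambda(t)=(\Lambda_{ij})_{i,j\in I}$ with $\tilde B(t)^T\Lambda(t)=(D'\ 0)$, $D'=\mathrm{diag}(d'_k)_{k\in I_{uf}}$, $d'_k\in\mathbb Z_{>0}$, and variables $X_i(t)$, $i\in I$. $M^\circ(t)=\bigoplus_{i\in I}\mathbb Zf_i\cong\mathbb Z^I$ carries $\lambda(f_i,f_j)=\Lambda_{ij}$. $\mathcal{LP}(t)=\bigoplus_{m\in M^\circ(t)}\Bbbk X(t)^m$ has commutative product $X^m\cdot X^{m'}=X^{m+m'}$ and twisted product $X^m*X^{m'}=v^{\lambda(m,m')}X^{m+m'}$; $X_i(t)=X(t)^{f_i}$;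 as an algebra it is taken with $*$, and $\mathcal F(t)$ is its skew-field of fractions. $Y_k(t)=X(t)^{\sum_ib_{ik}f_i}$ for $k\in I_{uf}$. $\mathcal P=\{X(t)^u:u\in\mathbb Z^{I_f}\}$ is the group of frozen factors (frozen variables are the same in all seeds). For $k\in I_{uf}$, $t'=\mu_kt$ has $b'_{ij}=-b_{ij}$ if $k\in\{i,j\}$, otherwise $b'_{ij}=b_{ij}+b_{ik}[b_{kj}]_++[-b_{ik}]_+b_{kj}$; $\Lambda(t')_{ij}=\lambda(f'_i,f'_j)$ with $f'_i=f_i$ ($i\ne k$), $f'_k=-f_k+\sum_j[-b_{jk}]_+f_j$; and $\mu_k^*:\mathcal F(t')\cong\mathcal F(t)$ sends $X_i(t')\mapsto X_i(t)$ ($i\ne k$), $X_k(t')\mapsto X(t)^{-f_k+\sum_j[-b_{jk}]_+f_j}+X(t)^{-f_k+\sum_j[b_{jk}]_+f_j}$. $\Delta^+$ is the set of seeds obtained from an initial seed by iterated mutations. A mutation sequence with $t_2=\overleftarrow\mu_{t_2,t_1}t_1$ induces the composite $\mu^*_{t_2,t_1}=\overleftarrow\mu_{t_2,t_1}^*:\mathcal F(t_2)\cong\mathcal F(t_1)$, which depends only on $t_1,t_2$. **Twist automorphisms.** Seeds $t,t'$ are similar up to a permutation $\sigma$ of $I_{uf}$ if $b_{\sigma i,\sigma j}(t')=b_{ij}(t)$ for $i,j\in I_{uf}$ and $d'_{\sigma k}(t')=d'_k(t)$ for $k\in I_{uf}$. For $t'=\overleftarrow\mu t\in\Delta^+$ similar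 to $t$ up to $\sigma$, a variation map is an algebra isomorphism $\mathrm{var}^t:\mathcal F(t)\cong\mathcal F(t')$ (for $*$) such that $\mathrm{var}^t(X_k(t))=p_k\cdot X_{\sigma k}(t')$ for some $p_k\in\mathcal P$ and $\mathrm{var}^t(Y_k(t))=Y_{\sigma k}(t')$ for $k\in I_{uf}$, and $\mathrm{var}^t(\mathcal P)=\mathcal P$. A (cluster) twist automorphism on $\mathcal F(t)$ (passing through $t'$) is a composite $\mathrm{tw}^t=\overleftarrow\mu^*\mathrm{var}^t:\mathcal F(t)\cong\mathcal F(t)$ of this kind. *)

(* Defs.v *)
From HB Require Import structures.
From mathcomp Require Import all_boot all_order all_algebra all_fingroup.
From mathcomp Require Import finmap.
From mathcomp.multinomials Require Import monalg.

Set Implicit Arguments.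
Unset Strict Implicit.
Unset Printing Implicit Defensive.

Import Order.TTheory GRing.Theory Num.Theory.
Local Open Scope ring_scope.

(** [{malg R[G]}] is the free R-module with basis (x^g)_(g in G); [twmul c] is
    its bilinear product with x^g x^h = c(g,h) x^(g+h). *)

Section TwistedProduct.
Variables (R : comNzRingType) (G : zmodType).
Implicit Types (c : G -> G -> R) (x y z : {malg R[G]}).

Definition twmul c x y : {malg R[G]} :=
  \sum_(g <- msupp x) \sum_(h <- msupp y)
    << x@_g * y@_h * c g h *g (g + h) >>.

Lemma twmulEw c (d e : {fset G}) x y :
    (msupp x `<=` d)%fset -> (msupp y `<=` e)%fset ->
  twmul c x y = \sum_(g <- d) \sum_(h <- e)
    << x@_g * y@_h * c g h *g (g + h) >>.
Proof.
move=> sxd sye; rewrite /twmul (big_fset_incl _ sxd) /=; last first.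
  move=> g _ /mcoeff_outdom ->; rewrite big1 // => h _.
  by rewrite !mul0r monalgU0.
apply: eq_bigr => g _; rewrite (big_fset_incl _ sye) //=.
by move=> h _ /mcoeff_outdom ->; rewrite mulr0 mul0r monalgU0.
Qed.

Lemma twmulDl c : left_distributive (twmul c) +%R.
Proof.
move=> x y z; pose d := (msupp x `|` msupp y)%fset.
rewrite !(@twmulEw c d (msupp z)) ?fsubsetUl ?fsubsetUr ?msuppD_le //.
rewrite -big_split; apply: eq_bigr => g _; rewrite -big_split.
by apply: eq_bigr => h _; rewrite mcoeffD !mulrDl monalgUD.
Qed.

Lemma twmulDr c : right_distributive (twmul c) +%R.
Proof.
move=> z x y; pose d := (msupp x `|` msupp y)%fset.
rewrite !(@twmulEw c (msupp z) d) ?fsubsetUl ?fsubsetUr ?msuppD_le //.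
rewrite -big_split; apply: eq_bigr => g _; rewrite -big_split.
by apply: eq_bigr => h _; rewrite mcoeffD mulrDr mulrDl monalgUD.
Qed.

Lemma twmul0l c : left_zero 0 (twmul c).
Proof. by move=> x; rewrite /twmul msupp0 big_seq_fset0. Qed.

Lemma twmul0r c : right_zero 0 (twmul c).
Proof.
by move=> x; rewrite /twmul big1 // => g _; rewrite msupp0 big_seq_fset0.
Qed.

Lemma twmulUU c (a b : R) (g h : G) :
  twmul c << a *g g >> << b *g h >> = << a * b * c g h *g (g + h) >>.
Proof.
rewrite (@twmulEw c [fset g]%fset [fset h]%fset) ?msuppU_le //.
by rewrite !big_seq_fset1 !mcoeffUU.
Qed.

Lemma twmul_suml c I (r : seq I) (F : I -> {malg R[G]}) y :
  twmul c (\sum_(i <- r) F i) y = \sum_(i <- r) twmul c (F i) y.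
Proof.
elim: r => [|i r IH]; first by rewrite !big_nil twmul0l.
by rewrite !big_cons twmulDl IH.
Qed.

Lemma twmul_sumr c I (r : seq I) (F : I -> {malg R[G]}) y :
  twmul c y (\sum_(i <- r) F i) = \sum_(i <- r) twmul c y (F i).
Proof.
elim: r => [|i r IH]; first by rewrite !big_nil twmul0r.
by rewrite !big_cons twmulDr IH.
Qed.

Lemma twmulZl c (a : R) x y : a *: twmul c x y = twmul c (a *: x) y.
Proof.
rewrite [RHS](@twmulEw c (msupp x) (msupp y)) ?msuppZ_le // scaler_sumr.
apply: eq_bigr => g _; rewrite scaler_sumr; apply: eq_bigr => h _.
apply/malgP => k; rewrite mcoeffZ mcoeffZ !mcoeffU.
by rewrite mulrnAr !mulrA.
Qed.

Lemma twmulZr c (a : R) x y : a *: twmul c x y = twmul c x (a *: y).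
Proof.
rewrite [RHS](@twmulEw c (msupp x) (msupp y)) ?msuppZ_le // scaler_sumr.
apply: eq_bigr => g _; rewrite scaler_sumr; apply: eq_bigr => h _.
apply/malgP => k; rewrite mcoeffZ mcoeffZ !mcoeffU.
by rewrite mulrnAr !mulrA [x@_g * a]mulrC.
Qed.

End TwistedProduct.

Record cocycle (R : comNzRingType) (G : zmodType) := Cocycle {
  cocycle_fun :> G -> G -> R;
  cocycle0l : forall g, cocycle_fun 0 g = 1;
  cocycle0r : forall g, cocycle_fun g 0 = 1;
  cocycleP : forall g h k,
    cocycle_fun g h * cocycle_fun (g + h) k =
    cocycle_fun h k * cocycle_fun g (h + k)
}.

Definition twalg (R : comNzRingType) (G : zmodType) (c : cocycle R G) : Type :=
  {malg R[G]}.

Section TwistedAlgebra.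
Variables (R : comNzRingType) (G : zmodType) (c : cocycle R G).

HB.instance Definition _ := GRing.Lmodule.copy (twalg c) {malg R[G]}.

Definition twone : twalg c := << 1 *g 0 >>.

Lemma twmul1l : left_id twone (twmul c).
Proof.
move=> x; rewrite [in RHS](monalgE x) [x in LHS]monalgE twmul_sumr.
by apply: eq_bigr => g _; rewrite twmulUU cocycle0l mul1r mulr1 add0r.
Qed.

Lemma twmul1r : right_id twone (twmul c).
Proof.
move=> x; rewrite [in RHS](monalgE x) [x in LHS]monalgE twmul_suml.
by apply: eq_bigr => g _; rewrite twmulUU cocycle0r !mulr1 addr0.
Qed.

Lemma twmulA : associative (twmul c).
Proof.
move=> x y z; rewrite (monalgE x) !twmul_suml; apply: eq_bigr => g _.
rewrite (monalgE y) twmul_suml !twmul_sumr twmul_suml; apply: eq_bigr => h _.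
rewrite (monalgE z) !twmul_sumr; apply: eq_bigr => k _.
rewrite !twmulUU addrA; congr (<< _ *g _ >>).
by rewrite -!mulrA; do 2!congr (_ * _); rewrite -cocycleP mulrCA.
Qed.

Lemma twone_neq0 : twone != 0.
Proof. by rewrite /twone monalgU_eq0 oner_eq0. Qed.

HB.instance Definition _ := GRing.Zmodule_isNzRing.Build (twalg c)
  twmulA twmul1l twmul1r (@twmulDl R G c) (@twmulDr R G c) twone_neq0.
HB.instance Definition _ := GRing.Lmodule_isLalgebra.Build R (twalg c)
  (@twmulZl R G c).
HB.instance Definition _ := GRing.Lalgebra_isAlgebra.Build R (twalg c)
  (@twmulZr R G c).

Definition twmon (g : G) : twalg c := << 1 *g g >>.

Lemma twmonM (g h : G) : twmon g * twmon h = c g h *: twmon (g + h).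
Proof.
apply/malgP => k; rewrite /twmon mcoeffZ.
rewrite [X in X@_k](_ : _ = << c g h *g (g + h) >>) ?mcoeffU ?mulrnAr ?mulr1 //.
by rewrite [LHS]twmulUU !mul1r.
Qed.

End TwistedAlgebra.

(** Z[v, v^-1], where v = q^(1/2), as the group algebra of the additive group
    [int] over the ring [int]. *)

Lemma cocycle1_proof (R : comNzRingType) : 1 * 1 = 1 * 1 :> R. Proof. by []. Qed.

Definition cocycle1 (R : comNzRingType) (G : zmodType) : cocycle R G :=
  @Cocycle R G (fun _ _ => 1) (fun _ => erefl) (fun _ => erefl)
    (fun _ _ _ => cocycle1_proof R).

Definition laurent : Type := twalg (cocycle1 int int).

HB.instance Definition _ := GRing.NzRing.on laurent.

Lemma laurent_mulC : commutative (@GRing.mul laurent).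
Proof.
move=> x y; change (twmul (cocycle1 int int) x y = twmul (cocycle1 int int) y x).
rewrite (monalgE x) twmul_suml twmul_sumr; apply: eq_bigr => g _.
rewrite (monalgE y) twmul_sumr twmul_suml; apply: eq_bigr => h _.
by rewrite !twmulUU addrC [_@__ * _@__]mulrC.
Qed.

HB.instance Definition _ := GRing.PzRing_hasCommutativeMul.Build laurent
  laurent_mulC.

Definition vpow (a : int) : laurent := twmon (cocycle1 int int) a.

Lemma vpowD a b : vpow (a + b) = vpow a * vpow b.
Proof. by rewrite /vpow [RHS]twmonM scale1r. Qed.

Definition bform (N : nat) (Lam : 'M[int]_N) (g h : 'rV[int]_N) : int :=
  (g *m Lam *m h^T) 0 0.

Section QuantumTorus.
Variables (N : nat) (Lam : 'M[int]_N).

Definition qcocycle_fun (g h : 'rV[int]_N) : laurent := vpow (bform Lam g h).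

Lemma qcocycle0l g : qcocycle_fun 0 g = 1.
Proof. by rewrite /qcocycle_fun /bform !mul0mx mxE. Qed.

Lemma qcocycle0r g : qcocycle_fun g 0 = 1.
Proof. by rewrite /qcocycle_fun /bform trmx0 mulmx0 mxE. Qed.

Lemma qcocycleP g h k :
  qcocycle_fun g h * qcocycle_fun (g + h) k =
  qcocycle_fun h k * qcocycle_fun g (h + k).
Proof.
rewrite /qcocycle_fun -!vpowD /bform linearD /= !(mulmxDl, mulmxDr).
by congr vpow; rewrite [X in _ + X = _]mxE [X in _ = _ + X]mxE addrA addrC.
Qed.

Definition qcocycle : cocycle laurent 'rV[int]_N :=
  Cocycle qcocycle0l qcocycle0r qcocycleP.

Definition qtorus : Type := twalg qcocycle.

HB.instance Definition _ := GRing.Algebra.on qtorus.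

Definition qmon (g : 'rV[int]_N) : qtorus := twmon qcocycle g.

Lemma qmonM g h : qmon g * qmon h = vpow (bform Lam g h) *: qmon (g + h).
Proof. exact: twmonM. Qed.

(* The untwisted product X^g . X^h = X^(g+h); [*%R] is the twisted one. *)
Definition cdot (x y : qtorus) : qtorus := twmul (cocycle1 laurent 'rV[int]_N) x y.

Lemma cdot_qmon g h : cdot (qmon g) (qmon h) = qmon (g + h).
Proof. by rewrite /cdot /qmon /twmon twmulUU !mulr1. Qed.

End QuantumTorus.

(** A division R-algebra containing A in which every element is a fraction
    a b^-1 with a, b in A.  For an Ore domain such as a quantum torus it exists
    and is unique up to a unique isomorphism over A. *)

Record skew_frac (R : comNzRingType) (A : algType R) := SkewFrac {
  frac_sort :> unitAlgType R;
  to_frac : {lrmorphism A -> frac_sort};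
  to_frac_inj : injective to_frac;
  frac_unit : forall x : frac_sort, x != 0 -> x \is a GRing.unit;
  frac_surj : forall x : frac_sort,
    exists a b : A, b != 0 /\ x = to_frac a / to_frac b
}.

(** A quantum seed is its pair of matrices; its variables are the generators
    [Xvar] of its own quantum torus.  The vertices are I = 'I_(n + m); the
    unfrozen ones are [lshift m k] with k : 'I_n and the frozen ones are
    [rshift n j] with j : 'I_m. *)

Record seed (n m : nat) := Seed {
  Bmat : 'M[int]_(n + m, n);
  Lmat : 'M[int]_(n + m)
}.

Definition posp (x : int) : int := Num.max x 0.

Section Seeds.
Variables (n m : nat).
Implicit Types (t : seed n m) (k : 'I_n).

Local Notation M0 := 'rV[int]_(n + m).

Definition fvec (i : 'I_(n + m)) : M0 := delta_mx 0 i.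

Definition skew_symmetrizable (B : 'M[int]_n) : Prop :=
  exists d : 'I_n -> int, (forall i, 0 < d i) /\
    (forall i j, d i * B i j = - (d j * B j i)).

Definition quantum_seed t : Prop :=
  [/\ \rank (map_mx (intr : int -> rat) (Bmat t)) = n,
      skew_symmetrizable (usubmx (Bmat t)),
      (Lmat t)^T = - Lmat t
    & exists d : 'rV[int]_n, (forall k, 0 < d 0 k) /\
        (Bmat t)^T *m Lmat t = row_mx (diag_mx d) 0].

(* The diagonal entry d'_k of B^T Lambda = (D' 0). *)
Definition dprime t k : int := ((Bmat t)^T *m Lmat t) k (lshift m k).

(* [gminus] and [gplus] are the two exponents of the exchange relation at k. *)
Definition gminus t k : M0 :=
  - fvec (lshift m k) + \sum_j posp (- Bmat t j k) *: fvec j.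

Definition gplus t k : M0 :=
  - fvec (lshift m k) + \sum_j posp (Bmat t j k) *: fvec j.

Definition fvec_mut t k (i : 'I_(n + m)) : M0 :=
  if i == lshift m k then gminus t k else fvec i.

Definition mut t k : seed n m :=
  Seed
    (\matrix_(i, j)
       if (i == lshift m k) || (j == k) then - Bmat t i j
       else Bmat t i j + Bmat t i k * posp (Bmat t (lshift m k) j)
            + posp (- Bmat t i k) * Bmat t (lshift m k) j)
    (\matrix_(i, j) bform (Lmat t) (fvec_mut t k i) (fvec_mut t k j)).

(* Delta^+, with initial seed t0. *)
Definition reachable (t0 t : seed n m) : Prop :=
  exists ks : seq 'I_n, t = foldl mut t0 ks.

Definition LP t := qtorus (Lmat t).

Definition Xmon t (g : M0) : LP t := qmon (Lmat t) g.
Definition Xvar t (i : 'I_(n + m)) : LP t := Xmon t (fvec i).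
Definition Yvar t k : LP t := Xmon t (\sum_i Bmat t i k *: fvec i).

Definition frozen_factor t (p : LP t) : Prop :=
  exists u : 'rV[int]_m, p = Xmon t (row_mx 0 u).

Definition similar (s : 'S_n) (t t' : seed n m) : Prop :=
  (forall i j, Bmat t' (lshift m (s i)) (s j) = Bmat t (lshift m i) j) /\
  (forall k, dprime t' (s k) = dprime t k).

End Seeds.

(** [F] chooses a skew-field of fractions of LP(t) for every seed t. *)

Section Twist.
Variables (n m : nat) (F : forall t : seed n m, skew_frac (LP t)).

Definition mutation_iso (t : seed n m) (k : 'I_n)
    (f : {lrmorphism F (mut t k) -> F t}) : Prop :=
  [/\ bijective f,
      forall i, i != lshift m k ->
        f (to_frac (F (mut t k)) (Xvar (mut t k) i)) = to_frac (F t) (Xvar t i)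
    & f (to_frac (F (mut t k)) (Xvar (mut t k) (lshift m k))) =
        to_frac (F t) (Xmon t (gminus t k) + Xmon t (gplus t k))].

(* Different mutation sequences may end at equal matrices with different
   composites F(t') -> F(t), so a point of Delta^+ seen from t is a seed t'
   together with such a composite. *)
Inductive mutation_seq (t : seed n m) :
    forall t' : seed n m, (F t' -> F t) -> Prop :=
| mutation_seq_nil : mutation_seq (fun x : F t => x)
| mutation_seq_rcons t' k (f : F t' -> F t)
    (g : {lrmorphism F (mut t' k) -> F t'}) :
    mutation_seq f -> mutation_iso g ->
    mutation_seq (fun x : F (mut t' k) => f (g x)).

Definition variation_map (s : 'S_n) (t t' : seed n m)
    (f : {lrmorphism F t -> F t'}) : Prop :=
  [/\ bijective f,
      forall k, exists2 p : LP t', frozen_factor p &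
        f (to_frac (F t) (Xvar t (lshift m k))) =
          to_frac (F t') (cdot p (Xvar t' (lshift m (s k)))),
      forall k, f (to_frac (F t) (Yvar t k)) = to_frac (F t') (Yvar t' (s k))
    & forall y : F t',
        (exists2 p : LP t, frozen_factor p & y = f (to_frac (F t) p)) <->
        (exists2 p : LP t', frozen_factor p & y = to_frac (F t') p)].

Definition twist_automorphism (t : seed n m) (tw : F t -> F t) : Prop :=
  exists (t' : seed n m) (mu : F t' -> F t) (s : 'S_n)
         (var : {lrmorphism F t -> F t'}),
    [/\ mutation_seq mu, similar s t t', variation_map s var
      & forall x, tw x = mu (var x)].

End Twist.

(* Main.v *)
Require Import Defs.
From HB Require Import structures.
From mathcomp Require Import all_boot all_order all_algebra all_fingroup.
From mathcomp Require Import finmap.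
From mathcomp.multinomials Require Import monalg.
From mathcomp Require Import zify ring.

Set Implicit Arguments.
Unset Strict Implicit.
Unset Printing Implicit Defensive.

Import Order.TTheory GRing.Theory Num.Theory.
Local Open Scope ring_scope.

(** Let tw = mu* var pass through t', similar to t up to sigma, and let s be
    obtained from t by mutating at k_1, ..., k_r.  Mutating t' at sigma k_1, ...,
    sigma k_r gives s', similar to s.  A variation map is the same thing as a
    lattice isomorphism P on exponents that preserves lambda, sends f_k to
    f_(sigma k) up to frozen exponents, preserves the frozen sublattice and
    sends y_k to y_(sigma k).  If E_k is the involution of the lattice with
    f_k |-> -f_k + sum_j [-b_jk]_+ f_j, then E_k P E_(sigma k) has the same
    properties for the mutated seeds, so it defines a variation map var^s.  The
    mutation isomorphism F(s') -> F(t') exists because it is the conjugate of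
    F(s) -> F(t) by the variation maps.  Hence tw^s is var^s followed by the
    mutations s' -> t' -> t -> s; the last one is a mutation sequence because
    mutations are involutive. *)

(** * Extension of morphisms to skew-fields of fractions *)

Lemma bij_lrmorphism (R : comNzRingType) (A B : algType R)
    (f : {lrmorphism A -> B}) : bijective f ->
  exists h : {lrmorphism B -> A}, cancel f h /\ cancel h f.
Proof.
move=> [h fK hK].
pose za := GRing.isZmodMorphism.Build B A h (can2_zmod_morphism fK hK).
pose ma := GRing.isMonoidMorphism.Build B A h (can2_monoid_morphism fK hK).
pose sa := GRing.isScalable.Build R B A *:%R h (can2_scalable fK hK).
pose h' : {lrmorphism B -> A} := HB.pack h za ma sa.
by exists h'.
Qed.

Section FractionExtension.
Variables (R : comNzRingType) (A : algType R) (K : skew_frac A).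

Let j : {lrmorphism A -> K} := @to_frac R A K.

Lemma to_frac_eq0 a : (j a == 0) = (a == 0).
Proof. exact: raddf_eq0 (@to_frac_inj R A K). Qed.

Lemma to_frac_unit a : a != 0 -> j a \is a GRing.unit.
Proof.
by move=> a0; apply: frac_unit; rewrite to_frac_eq0.
Qed.

Lemma frac_mulf_neq0 (a b : A) : a != 0 -> b != 0 -> a * b != 0.
Proof.
move=> a0 b0; rewrite -to_frac_eq0 rmorphM /=.
apply: contraTneq isT => ab0.
suff: 0 \is a @GRing.unit K by rewrite unitr0.
by rewrite -ab0 unitrMr to_frac_unit.
Qed.

(** The right Ore condition is read off the given skew-field: writing $b^{-1}a$ as a right fraction
    $cd^{-1}$ and clearing denominators gives an identity between images of [A]. *)
Lemma frac_ore (a b : A) : b != 0 -> exists c d : A, d != 0 /\ a * d = b * c.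
Proof.
move=> b0; have [c [d [d0 e]]] := frac_surj ((j b)^-1 * j a).
exists c, d; split=> //; apply: (@to_frac_inj R A K).
rewrite !rmorphM -/j /= -[LHS](mulVKr (to_frac_unit b0)) [_^-1 * _]mulrA e.
by rewrite divrK ?to_frac_unit.
Qed.

Variables (D : unitAlgType R) (phi : {lrmorphism A -> D}).
Hypothesis D_unit : forall x : D, x != 0 -> x \is a GRing.unit.
Hypothesis phi_inj : injective phi.

Let phi_unit a : a != 0 -> phi a \is a GRing.unit.
Proof. by move=> a0; apply: D_unit; rewrite raddf_eq0. Qed.

Let fracP (x : K) : exists ab : A * A, (ab.2 != 0) && (x == j ab.1 / j ab.2).
Proof. by have [a [b [b0 ->]]] := frac_surj x; exists (a, b); rewrite b0 /=. Qed.

Let ext (x : K) : D :=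
  let ab := xchoose (fracP x) in phi ab.1 / phi ab.2.

(** Independence of the representation chosen in [ext]: if $a/b=c/d$, the Ore condition gives a
    common denominator $be=df$, and then $ae=cf$ already holds in [A], so [phi] carries it over. *)
Let extE a b : b != 0 -> ext (j a / j b) = phi a / phi b.
Proof.
move=> b0; rewrite /ext.
have /andP[d0 /eqP] := xchooseP (fracP (j a / j b)).
case: (xchoose _) d0 => c d /= d0 E.
have [f [e [e0 bedf]]] := frac_ore b d0.
have aecf : a * e = c * f.
  apply: (@to_frac_inj R A K); rewrite !rmorphM -/j /=.
  rewrite -[j a](divrK (to_frac_unit b0)) E -!mulrA -[j b * j e]rmorphM.
  by rewrite /= bedf rmorphM /= mulKr ?to_frac_unit.
apply: (mulIr (phi_unit b0)); apply: (mulIr (phi_unit e0)).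
rewrite divrK ?phi_unit // -!mulrA -[phi b * phi e]rmorphM bedf -rmorphM.
by rewrite aecf !rmorphM /= mulKr ?phi_unit.
Qed.

Let ext_zmod : zmod_morphism ext.
Proof.
move=> x y; have [a [b [b0 ->]]] := frac_surj x.
have [c [d [d0 ->]]] := frac_surj y.
have [f [e [e0 bedf]]] := frac_ore b d0.
have be0 := frac_mulf_neq0 b0 e0.
have f0 : f != 0.
  by apply: contra_neq be0 => f0; rewrite bedf f0 mulr0.
have red (L : unitAlgType R) (p : {lrmorphism A -> L}) (u v w : A) :
    p v \is a GRing.unit -> p w \is a GRing.unit ->
    p u / p v = p (u * w) / p (v * w).
  by move=> uv uw; rewrite !rmorphM /= invrM // -!mulrA mulVKr.
rewrite -/j (red _ j a b e) ?to_frac_unit //.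
rewrite (red _ j c d f) ?to_frac_unit // -bedf -mulrBl -rmorphB !extE //.
by rewrite rmorphB mulrBl.
Qed.

Let ext_monoid : monoid_morphism ext.
Proof.
split=> [|x y].
  have := @extE 1 1 (oner_neq0 _).
  by rewrite !rmorph1 divr1 => ->; rewrite divr1.
have [a [b [b0 ->]]] := frac_surj x; have [c [d [d0 ->]]] := frac_surj y.
(* From $cf=be$ one gets $b^{-1}c=ef^{-1}$, so the product of the two fractions is
   $(ae)(df)^{-1}$. *)
have [e [f [f0 cfbe]]] := frac_ore c b0.
have red (L : unitAlgType R) (p : {lrmorphism A -> L}) :
    p b \is a GRing.unit -> p d \is a GRing.unit -> p f \is a GRing.unit ->
    p a / p b * (p c / p d) = p (a * e) / p (d * f).
  move=> ub ud uf; rewrite !rmorphM /= invrM // -!mulrA; congr (_ * _).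
  apply: (can_inj (mulKr ub)); rewrite mulVKr // [RHS]mulrA -rmorphM -cfbe.
  by rewrite rmorphM /= -mulrA mulVKr.
rewrite -/j (red _ j) ?to_frac_unit // !extE ?frac_mulf_neq0 //.
by rewrite (red _ phi) ?phi_unit.
Qed.

Let ext_scalable : scalable ext.
Proof.
move=> r x; have [a [b [b0 ->]]] := frac_surj x.
by rewrite -/j scalerAl -linearZ /= !extE // linearZ scalerAl.
Qed.

Lemma extend_to_frac :
  exists Phi : {lrmorphism K -> D}, forall a, Phi (to_frac K a) = phi a.
Proof.
pose za := GRing.isZmodMorphism.Build K D ext ext_zmod.
pose ma := GRing.isMonoidMorphism.Build K D ext ext_monoid.
pose sa := GRing.isScalable.Build R K D *:%R ext ext_scalable.
pose Phi : {lrmorphism K -> D} := HB.pack ext za ma sa.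
exists Phi => a; have := @extE a 1 (oner_neq0 _).
by rewrite !rmorph1 !divr1.
Qed.

End FractionExtension.

Lemma frac_isomorphism (R : comNzRingType) (A B : algType R)
    (K : skew_frac A) (L : skew_frac B)
    (f : {lrmorphism A -> B}) (h : {lrmorphism B -> A}) :
  cancel f h -> cancel h f ->
  exists2 Phi : {lrmorphism K -> L},
    bijective Phi & forall a, Phi (to_frac K a) = to_frac L (f a).
Proof.
move=> fK hK.
have extend (A' B' : algType R) (K' : skew_frac A') (L' : skew_frac B')
    (f' : {lrmorphism A' -> B'}) : injective f' ->
    exists Phi : {lrmorphism K' -> L'},
      forall a, Phi (to_frac K' a) = to_frac L' (f' a).
  move=> f'_inj.
  have [] := @extend_to_frac R A' K' L' (to_frac L' \o f')%FUN.
  - exact: frac_unit.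
  - by apply: inj_comp => //; apply: to_frac_inj.
  - by move=> Phi PhiE; exists Phi.
have [Phi PhiE] := extend _ _ K L f (can_inj fK).
have [Psi PsiE] := extend _ _ L K h (can_inj hK).
(* An endomorphism fixing the subalgebra fixes all fractions; applied to both composites, this makes
   the two extensions mutually inverse. *)
have ratK (A' : algType R) (K' : skew_frac A') (p : {lrmorphism K' -> K'}) :
    (forall a, p (to_frac K' a) = to_frac K' a) -> p =1 id.
  move=> pE x; have [a [b [b0 ->]]] := frac_surj x.
  by rewrite rmorphM /= rmorphV ?to_frac_unit //= !pE.
exists Phi => //; exists Psi => x.
  by apply: (ratK _ _ (Psi \o Phi)%FUN) => a; rewrite /= PhiE PsiE fK.
by apply: (ratK _ _ (Phi \o Psi)%FUN) => a; rewrite /= PsiE PhiE hK.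
Qed.

(** * Monomials in quantum tori *)

Section TwistedMap.
Variables (R : comNzRingType) (G H : zmodType).
Variables (c : cocycle R G) (c' : cocycle R H) (phi : {additive G -> H}).
Hypothesis phi_cocycle : forall g h, c' (phi g) (phi h) = c g h.

Lemma twalgE (x : twalg c) : x = \sum_(g <- msupp x) x@_g *: twmon c g.
Proof.
rewrite [LHS]monalgE; apply: eq_bigr => g _; apply/malgP => h.
by rewrite mcoeffZ !mcoeffU mulrnAr mulr1.
Qed.

Let twmap (x : twalg c) : twalg c' :=
  \sum_(g <- msupp x) x@_g *: twmon c' (phi g).

Let twmapEw (d : {fset G}) (x : twalg c) : (msupp x `<=` d)%fset ->
  twmap x = \sum_(g <- d) x@_g *: twmon c' (phi g).
Proof.
move=> xd; rewrite /twmap (big_fset_incl _ xd) //= => g _ /mcoeff_outdom ->.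
by rewrite scale0r.
Qed.

Let twmap_linear : linear twmap.
Proof.
move=> a x y; pose d := (msupp x `|` msupp y `|` msupp (a *: x + y))%fset.
rewrite (@twmapEw d) ?fsubsetUr // (@twmapEw d x) ?(@twmapEw d y); last first.
- by rewrite /d -fsetUA fsubsetUl.
- by rewrite /d fsetUAC fsubsetUr.
rewrite scaler_sumr -big_split; apply: eq_bigr => g _ /=.
by rewrite scalerA -scalerDl mcoeffD mcoeffZ.
Qed.

Let twmapU g : twmap (twmon c g) = twmon c' (phi g).
Proof.
rewrite (@twmapEw [fset g]%fset) ?msuppU_le // big_seq_fset1 mcoeffUU.
by rewrite scale1r.
Qed.

(** By bilinearity, multiplicativity of the linear extension only has to hold on monomials, where it
    is [phi_cocycle]. *)
Lemma twalg_map : exists f : {lrmorphism twalg c -> twalg c'},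
  forall g, f (twmon c g) = twmon c' (phi g).
Proof.
pose la := GRing.isLinear.Build R (twalg c) (twalg c') *:%R twmap twmap_linear.
pose lin : {linear twalg c -> twalg c'} := HB.pack twmap la.
have mul : monoid_morphism lin.
  split=> [|x y]; first by rewrite /= [LHS]twmapU raddf0.
  rewrite [x in lin (x * y)]twalgE mulr_suml linear_sum.
  rewrite [RHS]mulr_suml; apply: eq_bigr => g _.
  rewrite [y in lin (_ * y)]twalgE mulr_sumr linear_sum.
  rewrite [RHS]mulr_sumr; apply: eq_bigr => h _.
  rewrite -!scalerAl -!scalerAr !twmonM !linearZ /= twmapU.
  rewrite phi_cocycle (raddfD phi) !scalerA; congr (_ *: _); ring.
pose ma := GRing.isMonoidMorphism.Build (twalg c) (twalg c') lin mul.
pose f : {lrmorphism twalg c -> twalg c'} := HB.pack (lin : _ -> _) la ma.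
by exists f => g; apply: twmapU.
Qed.

End TwistedMap.

Lemma vpow_inj : injective vpow.
Proof.
move=> a b /malgP/(_ b); rewrite /vpow /twmon !mcoeffUU mcoeffU.
by case: eqP.
Qed.

Section QuantumTorusMap.
Variables (N : nat).
Implicit Types (L : 'M[int]_N) (g h : 'rV[int]_N).

Lemma bformDl L g1 g2 h : bform L (g1 + g2) h = bform L g1 h + bform L g2 h.
Proof. by rewrite /bform !mulmxDl mxE. Qed.

Lemma bformZl L a g h : bform L (a *: g) h = a * bform L g h.
Proof. by rewrite /bform -!scalemxAl mxE. Qed.

Lemma bformNl L g h : bform L (- g) h = - bform L g h.
Proof. by rewrite -scaleN1r bformZl mulN1r. Qed.

Lemma bform_skew L g h : L^T = - L -> bform L g h = - bform L h g.
Proof.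
move=> skL; rewrite /bform -[in LHS](trmxK L) skL linearN /= mulmxN mulNmx mxE.
congr (- _); rewrite -[in LHS](trmxK g) -trmx_mul -trmx_mul mulmxA.
by rewrite mxE.
Qed.

Lemma bformDr L g h1 h2 : bform L g (h1 + h2) = bform L g h1 + bform L g h2.
Proof. by rewrite /bform linearD mulmxDr mxE. Qed.

Lemma bformZr L a g h : bform L g (a *: h) = a * bform L g h.
Proof. by rewrite /bform linearZ -scalemxAr mxE. Qed.

Lemma bformNr L g h : bform L g (- h) = - bform L g h.
Proof. by rewrite -scaleN1r bformZr mulN1r. Qed.

Lemma bform_conj L (P : 'M[int]_N) g h :
  bform (P *m L *m P^T) g h = bform L (g *m P) (h *m P).
Proof. by rewrite /bform trmx_mul !mulmxA. Qed.

Lemma bform_delta L i j : bform L (delta_mx 0 i) (delta_mx 0 j) = L i j.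
Proof. by rewrite /bform -rowE trmx_delta -colE !mxE. Qed.

Lemma bformE L g h : bform L g h = \sum_i \sum_j g 0 i * h 0 j * L i j.
Proof.
rewrite /bform mxE exchange_big; apply: eq_bigr => j _ /=.
rewrite !mxE mulr_suml; apply: eq_bigr => i _.
by rewrite mulrAC.
Qed.

Lemma qmon_inj L : injective (qmon L).
Proof.
move=> g h E; have E1 : (qmon L g)@_h = 1 by rewrite E mcoeffUU.
apply/eqP/negPn/negP => /negPf gh; move/eqP: E1.
by rewrite mcoeffU gh eq_sym oner_eq0.
Qed.

Lemma qmon_neq0 L g : qmon L g != 0.
Proof. by rewrite /qmon /twmon monalgU_eq0 oner_eq0. Qed.

Lemma qmon_scale_inj L a b g : vpow a *: qmon L g = vpow b *: qmon L g -> a = b.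
Proof.
have coef (x : laurent) : (x *: qmon L g)@_g = x.
  by rewrite mcoeffZ [X in _ * X]mcoeffUU mulr1.
by move=> E; apply: vpow_inj; rewrite -[LHS]coef E coef.
Qed.

Lemma qtorus_map (L L' P : 'M[int]_N) : P *m L' *m P^T = L ->
  exists f : {lrmorphism qtorus L -> qtorus L'},
    forall g, f (qmon L g) = qmon L' (g *m P).
Proof.
move=> PL; have [g h|f fE] := @twalg_map laurent _ _ (qcocycle L) (qcocycle L')
  (mulmxr P); last by exists f.
by rewrite /= /qcocycle_fun -PL bform_conj.
Qed.

Lemma qtorus_morph_id L (p : {lrmorphism qtorus L -> qtorus L}) :
  (forall g, p (qmon L g) = qmon L g) -> p =1 id.
Proof.
move=> pE x; rewrite [x in LHS]twalgE (linear_sum p) [RHS]twalgE.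
apply: eq_bigr => g _.
by apply: etrans (linearZ_LR p _ _) _; congr (_ *: _); apply: pE.
Qed.

End QuantumTorusMap.

(** * Families of monomials inside an arbitrary algebra *)

Section QuantumTorusRep.
Variables (D : algType laurent) (N : nat).
Implicit Types (L : 'M[int]_N) (g h : 'rV[int]_N) (X : 'rV[int]_N -> D).

Lemma vpow_scaleI a : injective ( *:%R (vpow a) : D -> D).
Proof.
move=> x y /(congr1 ( *:%R (vpow (- a)))).
by rewrite !scalerA -vpowD addNr !scale1r.
Qed.

(** The relations of the quantum torus, imposed on a family of elements of any algebra. They apply
    equally to the monomials of a skew-field and to their images under a morphism. *)
Definition torus_rep L X : Prop :=
  X 0 = 1 /\ forall g h, X g * X h = vpow (bform L g h) *: X (g + h).

Lemma torus_repNr L X g : L^T = - L -> torus_rep L X -> X g * X (- g) = 1.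
Proof.
move=> skL [X0 XM]; rewrite XM bformNr.
have -> : bform L g g = 0 by have := bform_skew g g skL; lia.
by rewrite oppr0 addrN scale1r.
Qed.

(* [X g * X h = v^(2 lambda(g, h)) X h * X g] determines [lambda]. *)
Lemma torus_rep_bform L L' X Y g h g' h' :
  L^T = - L -> L'^T = - L' -> torus_rep L X -> torus_rep L' Y ->
  X g = Y g' -> X h = Y h' ->
  (forall a b x, vpow a *: Y x = vpow b *: Y x -> a = b) ->
  bform L g h = bform L' g' h'.
Proof.
move=> skL skL' [_ XM] [_ YM] gE hE Yinj.
have comm L0 (Z : 'rV[int]_N -> D) g0 h0 : L0^T = - L0 ->
    (forall g h, Z g * Z h = vpow (bform L0 g h) *: Z (g + h)) ->
    Z g0 * Z h0 = vpow (2%:Z * bform L0 g0 h0) *: (Z h0 * Z g0).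
  move=> skL0 ZM; rewrite !ZM scalerA -vpowD (bform_skew h0) // addrC [h0 + _]addrC.
  by congr (vpow _ *: _); lia.
have := comm _ _ g h skL XM; rewrite gE hE (comm _ _ g' h' skL' YM) YM !scalerA -!vpowD.
by move/Yinj; lia.
Qed.

(** The exponents supported on [S] where the two families agree form a subgroup, because the forms
    match on [S], and it contains the generators. A proper subset [S] serves for mutation, which
    moves one variable. *)
Lemma torus_rep_ext (L L' P : 'M[int]_N) (S : {pred 'I_N}) X Y :
  L^T = - L -> L'^T = - L' -> torus_rep L X -> torus_rep L' Y ->
  {in S &, forall i j, L i j = (P *m L' *m P^T) i j} ->
  {in S, forall i, X (delta_mx 0 i) = Y (delta_mx 0 i *m P)} ->
  forall g, {in [predC S], forall i, g 0 i = 0} -> X g = Y (g *m P).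
Proof.
move=> skL skL' repX repY eqL eqS.
pose Q g := {in [predC S], forall i, g 0 i = 0} /\ X g = Y (g *m P).
have qsupp g h : {in [predC S], forall i, g 0 i = 0} ->
    {in [predC S], forall i, h 0 i = 0} ->
    bform L g h = bform L' (g *m P) (h *m P).
  move=> g0 h0; rewrite -bform_conj !bformE; apply: eq_bigr => i _.
  apply: eq_bigr => j _.
  have [iS|iS] := boolP (i \in S); last by rewrite g0 // !mul0r.
  have [jS|jS] := boolP (j \in S); last by rewrite h0 // mulr0 !mul0r.
  by rewrite eqL.
have QD g h : Q g -> Q h -> Q (g + h).
  move=> [g0 gE] [h0 hE]; split=> [i iS|].
    by rewrite mxE g0 // h0 // addr0.
  apply: (@vpow_scaleI (bform L g h)); rewrite -repX.2 gE hE.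
  by rewrite repY.2 -qsupp // mulmxDl.
(* No division in [D] is used: the inverse of a monomial is the monomial of opposite exponent. *)
have QN g : Q g -> Q (- g).
  move=> [g0 gE]; split=> [i iS|]; first by rewrite mxE g0 ?oppr0.
  rewrite -[LHS]mul1r -(torus_repNr (- (g *m P)) skL' repY) opprK -gE mulNmx.
  by rewrite -mulrA (torus_repNr g skL repX) mulr1.
have Q0 : Q 0.
  by split=> [i _|]; rewrite ?mxE // mul0mx repX.1 repY.1.
have QZ (a : int) g : Q g -> Q (a *: g).
  move=> Qg; have Qn k : Q (k%:Z *: g).
    elim: k => [|k IH]; first by rewrite scale0r.
    by rewrite intS scalerDl scale1r; apply: QD.
  by case: a => k //; rewrite NegzE scaleNr; apply: QN.
move=> g gS; suff: Q g by case.
rewrite (row_sum_delta g); elim/big_ind: _ => // i _.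
have [iS|iS] := boolP (i \in S); last by rewrite gS // scale0r.
apply: QZ; split=> [k kS|]; last exact: eqS.
by rewrite mxE eqxx; case: eqP => // ki; rewrite ki inE iS in kS.
Qed.

End QuantumTorusRep.

Lemma torus_rep_morph N (L : 'M[int]_N) (C D : algType laurent)
    (f : {lrmorphism C -> D}) (X : 'rV[int]_N -> C) :
  torus_rep L X -> torus_rep L (fun g => f (X g)).
Proof.
move=> [X0 XM]; split=> [|g h]; first by rewrite X0; apply: (rmorph1 f).
by rewrite -(rmorphM f) XM; apply: (linearZ_LR f).
Qed.

(** * Mutation of compatible pairs *)

Lemma pospN x : posp x - posp (- x) = x.
Proof. by rewrite /posp; lia. Qed.

Section SeedMutation.
Variables (n m : nat).
Implicit Types (t : seed n m) (k j : 'I_n) (d : 'rV[int]_n).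
Implicit Types (g h : 'rV[int]_(n + m)).

(** The vector [d] is a parameter so that its invariance under mutation can be stated. *)
Definition compatible d t : Prop :=
  [/\ (Lmat t)^T = - Lmat t, forall k, 0 < d 0 k
    & (Bmat t)^T *m Lmat t = row_mx (diag_mx d) 0].

Lemma quantum_seed_compatible t : quantum_seed t -> exists d, compatible d t.
Proof. by case=> _ _ sk [d [d0 dE]]; exists d. Qed.

Definition yvec t k : 'rV[int]_(n + m) := \sum_i Bmat t i k *: fvec i.

Lemma fvecE (i i' : 'I_(n + m)) : (fvec i : 'rV[int]_(n + m)) 0 i' = (i' == i)%:R.
Proof. by rewrite mxE. Qed.

Lemma yvec_row t k : yvec t k = row k (Bmat t)^T.
Proof.
rewrite [RHS]row_sum_delta; apply: eq_bigr => i _.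
by rewrite !mxE.
Qed.

Lemma yvecE t k i : yvec t k 0 i = Bmat t i k.
Proof. by rewrite yvec_row !mxE. Qed.

Lemma gminusE t k i :
  gminus t k 0 i = posp (- Bmat t i k) - (i == lshift m k)%:R.
Proof.
rewrite /gminus !mxE summxE addrC; congr (_ - _).
rewrite (bigD1 i) //= big1 ?addr0 => [|j ji]; rewrite !mxE eqxx /=.
  by rewrite eqxx mulr1.
by rewrite eq_sym (negPf ji) mulr0.
Qed.

Lemma gplusE t k : gplus t k = gminus t k + yvec t k.
Proof.
rewrite /gplus /gminus /yvec -addrA -big_split; congr (_ + _).
apply: eq_bigr => i _; rewrite /= -scalerDl; congr (_ *: _).
by have := pospN (Bmat t i k); lia.
Qed.

(** This is $\tilde B^T\Lambda=(D'\ 0)$ read through the form: $y_k$ pairs only with $f_k$, and to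
    $d'_k$. *)
Lemma bform_yvec d t k g : compatible d t ->
  bform (Lmat t) (yvec t k) g = d 0 k * g 0 (lshift m k).
Proof.
move=> [_ _ BL]; rewrite yvec_row /bform -row_mul BL mxE.
rewrite big_split_ord /= [X in _ + X]big1 ?addr0 => [|i _]; last first.
  by rewrite mxE row_mxEr mxE mul0r.
rewrite (bigD1 k) //= big1 ?addr0 => [|i ik].
  by rewrite mxE row_mxEl !mxE eqxx.
by rewrite mxE row_mxEl mxE eq_sym (negPf ik) mul0r.
Qed.

Lemma dprimeE d t k : compatible d t -> dprime t k = d 0 k.
Proof.
by case=> _ _ BL; rewrite /dprime BL row_mxEl !mxE eqxx.
Qed.

(** The two products are $\lambda(y_j,y_k)$ and $\lambda(y_k,y_j)$ by [bform_yvec]. *)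
Lemma compatible_skew d t j k : compatible d t ->
  d 0 j * Bmat t (lshift m j) k = - (d 0 k * Bmat t (lshift m k) j).
Proof.
move=> ct; have [skL _ _] := ct.
by rewrite -!yvecE -!(bform_yvec _ _ ct) bform_skew.
Qed.

Lemma compatible_diag d t k : compatible d t -> Bmat t (lshift m k) k = 0.
Proof.
move=> ct; have [_ d0 _] := ct.
have := compatible_skew k k ct; move: (d0 k); nia.
Qed.

(* Row [i] is [f'_i] written in the basis [f] of [t]. *)
Definition mut_mx t k : 'M[int]_(n + m) :=
  1%:M + (fvec (lshift m k))^T *m (gminus t k - fvec (lshift m k)).

Lemma mul_mut_mx t k g :
  g *m mut_mx t k = g + g 0 (lshift m k) *: (gminus t k - fvec (lshift m k)).
Proof.
rewrite mulmxDr mulmx1 mulmxA /fvec trmx_delta -colE; congr (_ + _).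
by rewrite [col _ _]mx11_scalar mul_scalar_mx mxE.
Qed.

Lemma fvec_mut_mx t k i : fvec i *m mut_mx t k = fvec_mut t k i.
Proof.
rewrite mul_mut_mx fvecE /fvec_mut eq_sym; case: eqP => [->|_].
  by rewrite scale1r addrC subrK.
by rewrite scale0r addr0.
Qed.

Lemma mul_mut_mx_fix t k g : g 0 (lshift m k) = 0 -> g *m mut_mx t k = g.
Proof. by rewrite mul_mut_mx => ->; rewrite scale0r addr0. Qed.

Lemma Lmat_mut t k :
  Lmat (mut t k) = mut_mx t k *m Lmat t *m (mut_mx t k)^T.
Proof.
apply/matrixP => i j; rewrite mxE -[RHS]bform_delta bform_conj.
by rewrite !fvec_mut_mx.
Qed.

Lemma Lmat_mut_skew t k : (Lmat t)^T = - Lmat t ->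
  (Lmat (mut t k))^T = - Lmat (mut t k).
Proof.
move=> skL; rewrite Lmat_mut !trmx_mul trmxK skL mulNmx mulmxN.
by rewrite mulmxA.
Qed.

(** Since $b_{kk}=0$, the coefficient of $f_k$ in [gminus t k] is $-1$, so the matrix is a
    reflection. *)
Lemma mut_mxK d t k : compatible d t -> mut_mx t k *m mut_mx t k = 1%:M.
Proof.
move=> ct; apply/row_matrixP => i; rewrite !rowE mulmxA mulmx1 !mul_mut_mx.
apply/rowP => i'; rewrite !(gminusE, mxE) (compatible_diag _ ct) !eqxx /=.
by rewrite /posp oppr0 maxxx; ring.
Qed.

(** The tropical mutation rule for the $y$-vectors. In a row $i\ne k$, the term $[-b_{ik}]_+b_{kj}$
    of the matrix mutation cancels against the contribution of $f'_k$, whose coefficient is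
    $-b_{kj}$. *)
Lemma yvec_mut d t k j : compatible d t ->
  yvec (mut t k) j *m mut_mx t k =
  if j == k then - yvec t k
  else yvec t j + posp (Bmat t (lshift m k) j) *: yvec t k.
Proof.
move=> ct; rewrite mul_mut_mx; apply/rowP => i.
rewrite !(gminusE, yvecE, mxE) eqxx /= fun_if.
have [->|jk] := eqVneq j k.
  by rewrite !orbT !mxE yvecE (compatible_diag _ ct) oppr0 mul0r addr0.
rewrite !orbF !mxE !yvecE; case: (eqVneq i (lshift m k)) => [->|_].
  rewrite (compatible_diag _ ct) oppr0 /posp; lia.
rewrite subr0; lia.
Qed.

(** The entries of the mutated product are the values $\lambda(y'_j,f'_i)$, which [yvec_mut] and
    [bform_yvec] evaluate in the old basis. *)
Lemma compatible_mut d t k : compatible d t -> compatible d (mut t k).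
Proof.
move=> ct; have [skL d0 _] := ct; split=> //; first exact: Lmat_mut_skew.
apply/matrixP => j i; transitivity (bform (Lmat (mut t k)) (yvec (mut t k) j) (fvec i)).
  by rewrite /bform yvec_row -row_mul /fvec trmx_delta -colE !mxE.
rewrite Lmat_mut bform_conj (yvec_mut _ _ ct) fvec_mut_mx.
have -> : row_mx (diag_mx d) (0 : 'M_(n, m)) j i = d 0 j * (i == lshift m j)%:R.
  case: (split_ordP i) => i' ->; rewrite ?row_mxEl ?row_mxEr mxE.
    by rewrite (inj_eq (@lshift_inj _ _)) mulr_natr eq_sym.
  by rewrite eq_rlshift mulr0.
rewrite /fvec_mut; case: (eqVneq i (lshift m k)) => [->|ik].
  case: eqVneq => [->|jk].
    rewrite bformNl (bform_yvec _ _ ct) gminusE (compatible_diag _ ct) oppr0.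
    by rewrite /posp maxxx eqxx; lia.
  rewrite bformDl bformZl !(bform_yvec _ _ ct) !gminusE (compatible_diag _ ct).
  rewrite !(inj_eq (@lshift_inj _ _)) eqxx (negPf jk) eq_sym (negPf jk).
  (* Here $d'_j[-b_{jk}]_+$ cancels $d'_k[b_{kj}]_+$, because $-d'_jb_{jk}=d'_kb_{kj}$. *)
  have := compatible_skew j k ct; move: (d0 j) (d0 k); rewrite /posp; nia.
case: eqVneq => [->|jk].
  by rewrite bformNl (bform_yvec _ _ ct) fvecE eq_sym (negPf ik) mulr0 oppr0.
rewrite bformDl bformZl !(bform_yvec _ _ ct) !fvecE.
by rewrite [lshift m k == i]eq_sym (negPf ik) !mulr0 addr0 eq_sym.
Qed.

Lemma Bmat_mutK t k : Bmat (mut (mut t k) k) = Bmat t.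
Proof.
apply/matrixP => i j; rewrite !mxE !eqxx !orbT /=.
case: ((i == _) || (j == k)) => /=; first by rewrite opprK.
rewrite opprK; move: (pospN (Bmat t i k)) (pospN (Bmat t (lshift m k) j)).
move: (posp (- Bmat t i k)) (posp (Bmat t i k)) => a b.
move: (posp (- Bmat t (lshift m k) j)) (posp (Bmat t (lshift m k) j)) => c e.
by move=> <- <-; ring.
Qed.

(** The two reflections do not compose to the identity but to the transvection $g\mapsto g+g_ky_k$.
    It preserves the form, since $\lambda(y_k,\cdot)$ is $d'_k$ times the $k$-th coordinate, so
    $\Lambda$ returns to itself. *)
Lemma mutK d t k : compatible d t -> mut (mut t k) k = t.
Proof.
move=> ct; have cu := compatible_mut k ct.
suff LK : Lmat (mut (mut t k) k) = Lmat t.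
  by case: t LK {ct cu} (Bmat_mutK t k) => B L /= LK BK; rewrite /mut LK BK.
have [skL _ _] := ct.
pose fy g := g + g 0 (lshift m k) *: yvec t k.
have EE g : g *m mut_mx (mut t k) k *m mut_mx t k = fy g.
  rewrite !mul_mut_mx; apply/rowP => i; rewrite !(gminusE, yvecE, mxE).
  rewrite !eqxx !orbT (compatible_diag _ ct) !oppr0 opprK.
  rewrite -[in RHS](pospN (Bmat t i k)).
  by rewrite /posp maxxx /=; ring.
apply/matrixP => i j; rewrite -!bform_delta !(Lmat_mut _ k) !bform_conj !EE /fy.
rewrite -/(fvec i) -/(fvec j) !fvecE bformDl !bformDr !bformZl !bformZr.
rewrite (bform_skew (fvec i) (yvec t k)) // !(bform_yvec _ _ ct) !fvecE yvecE.
rewrite (compatible_diag _ ct).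
by ring.
Qed.

End SeedMutation.
(** * Variation maps on exponents *)

Section LatticeVariation.
Variables (n m : nat).
Implicit Types (t : seed n m) (k j : 'I_n) (d : 'rV[int]_n) (s : 'S_n).
Implicit Types (g h : 'rV[int]_(n + m)) (P : 'M[int]_(n + m)).

Lemma similar_mut d d' s t t' k : compatible d t -> compatible d' t' ->
  Defs.similar s t t' -> Defs.similar s (mut t k) (mut t' (s k)).
Proof.
move=> ct ct' [sB sd]; split=> [i j|j].
  by rewrite !mxE !(inj_eq (@lshift_inj _ _)) !(inj_eq perm_inj) !sB.
rewrite (dprimeE _ (compatible_mut _ ct)) (dprimeE _ (compatible_mut _ ct')).
by rewrite -(dprimeE _ ct) -(dprimeE _ ct').
Qed.

(* The action on exponents of a variation map, acting on row vectors. *)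
Definition lattice_variation s t t' P : Prop :=
  [/\ P \in unitmx,
      P *m Lmat t' *m P^T = Lmat t,
      forall k, exists u : 'rV[int]_m,
        fvec (lshift m k) *m P = row_mx 0 u + fvec (lshift m (s k)),
      forall h, (exists u : 'rV[int]_m, h = row_mx 0 u *m P) <->
                (exists u : 'rV[int]_m, h = row_mx 0 u)
    & forall k, yvec t k *m P = yvec t' (s k)].

Lemma frozen_lshift (u : 'rV[int]_m) k : (row_mx (0 : 'rV[int]_n) u) 0 (lshift m k) = 0.
Proof. by rewrite row_mxEl mxE. Qed.

Lemma frozenP g : (forall k, g 0 (lshift m k) = 0) ->
  exists u : 'rV[int]_m, g = row_mx 0 u.
Proof.
move=> g0; exists (rsubmx g); rewrite -[LHS]hsubmxK; congr row_mx.
by apply/rowP => k; rewrite !mxE g0.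
Qed.

Lemma fvec_rshift (i : 'I_m) : fvec (rshift n i) = row_mx 0 (delta_mx 0 i).
Proof.
apply/rowP => i'; rewrite fvecE; case: (split_ordP i') => i'' ->.
  by rewrite row_mxEl mxE eq_lrshift.
by rewrite row_mxEr mxE eqxx (inj_eq (@rshift_inj _ _)).
Qed.

Lemma lattice_variation_lshift s t t' P g k : lattice_variation s t t' P ->
  (g *m P) 0 (lshift m (s k)) = g 0 (lshift m k).
Proof.
move=> [_ _ Pf Pfr _]; rewrite [in LHS](row_sum_delta g) mulmx_suml summxE.
rewrite big_split_ord /= [X in _ + X]big1 => [|i _].
  rewrite addr0 (bigD1 k) //= big1 ?addr0 => [|j jk].
    have [u uE] := Pf k; rewrite -scalemxAl mxE -/(fvec _) uE mxE frozen_lshift.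
    by rewrite fvecE eqxx add0r mulr1.
  have [u uE] := Pf j; rewrite -scalemxAl mxE -/(fvec _) uE mxE frozen_lshift.
  rewrite fvecE (inj_eq (@lshift_inj _ _)) (inj_eq perm_inj) eq_sym (negPf jk).
  by rewrite add0r mulr0.
have [|u uE] := (Pfr (fvec (rshift n i) *m P)).1.
  by exists (delta_mx 0 i); rewrite fvec_rshift.
by rewrite -scalemxAl mxE -/(fvec _) uE frozen_lshift mulr0.
Qed.

(** The unfrozen coordinates of [gminus] involve only the square part of $\tilde B$, which
    similarity matches. *)
Lemma lattice_variation_gminus d d' s t t' P k :
  compatible d t -> compatible d' t' -> Defs.similar s t t' ->
  lattice_variation s t t' P ->
  exists u : 'rV[int]_m, gminus t k *m P = row_mx 0 u + gminus t' (s k).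
Proof.
move=> ct ct' [sB _] vP.
have [|u uE] := @frozenP (gminus t k *m P - gminus t' (s k)); last first.
  by exists u; rewrite -uE subrK.
move=> j; rewrite -(permKV s j) mxE (lattice_variation_lshift _ _ vP) [X in _ + X]mxE !gminusE.
by rewrite sB !(inj_eq (@lshift_inj _ _)) (inj_eq perm_inj) subrr.
Qed.

(** The same lattice isomorphism in the mutated bases: the right factor stands for its own inverse.
    Both reflections fix frozen exponents; the condition at $f'_k$ reduces to
    [lattice_variation_gminus], and the one on $y$-vectors to [yvec_mut]. *)
Lemma lattice_variation_mut d d' s t t' P k :
  compatible d t -> compatible d' t' -> Defs.similar s t t' ->
  lattice_variation s t t' P ->
  lattice_variation s (mut t k) (mut t' (s k))
    (mut_mx t k *m P *m mut_mx t' (s k)).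
Proof.
move=> ct ct' sim vP; have [Pu PL Pf Pfr Py] := vP; have [sB _] := sim.
set E := mut_mx t k; set E' := mut_mx t' (s k).
have EK : E *m E = 1%:M := mut_mxK k ct.
have EK' : E' *m E' = 1%:M := mut_mxK (s k) ct'.
have fixE (u : 'rV[int]_m) t1 k1 : row_mx 0 u *m mut_mx t1 k1 = row_mx 0 u.
  by rewrite mul_mut_mx_fix ?frozen_lshift.
split.
- by rewrite !unitmx_mul Pu (mulmx1_unit EK).1 (mulmx1_unit EK').1.
- apply/matrixP => i j; rewrite -!bform_delta bform_conj !Lmat_mut !bform_conj.
  have K g : g *m (E *m P *m E') *m E' = g *m E *m P.
    by rewrite -mulmxA -[_ *m E' *m E']mulmxA EK' mulmx1 mulmxA.
  by rewrite !K -PL bform_conj.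
- move=> j; rewrite !mulmxA fvec_mut_mx /fvec_mut (inj_eq (@lshift_inj _ _)).
  have [->|jk] := eqVneq j k.
    have [u ->] := lattice_variation_gminus k ct ct' sim vP; exists u.
    rewrite mulmxDl fixE; congr (_ + _).
    have -> : gminus t' (s k) = fvec (lshift m (s k)) *m E'.
      by rewrite fvec_mut_mx /fvec_mut eqxx.
    by rewrite -mulmxA EK' mulmx1.
  have [u ->] := Pf j; exists u; rewrite mulmxDl fixE mul_mut_mx_fix //.
  by rewrite fvecE (inj_eq (@lshift_inj _ _)) (inj_eq perm_inj) eq_sym (negPf jk).
- move=> h; split=> [[u ->]|[u ->]].
    rewrite !mulmxA fixE.
    have [|v ->] := (Pfr (row_mx 0 u *m P)).1; first by exists u.
    by exists v; rewrite fixE.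
  have [|v vE] := (Pfr (row_mx 0 u)).2; first by exists u.
  by exists v; rewrite !mulmxA fixE -vE fixE.
move=> j; rewrite !mulmxA (yvec_mut _ _ ct).
transitivity (yvec (mut t' (s k)) (s j) *m E' *m E'); last first.
  by rewrite -mulmxA EK' mulmx1.
congr (_ *m _); rewrite (yvec_mut _ _ ct') (inj_eq perm_inj).
case: ifP => _; first by rewrite mulNmx Py.
by rewrite mulmxDl -scalemxAl !Py sB.
Qed.

Lemma gplus_mut t k : gplus (mut t k) k = gminus t k.
Proof.
congr (_ + _); apply: eq_bigr => i _.
by rewrite mxE eqxx orbT.
Qed.

Lemma gminus_mut t k : gminus (mut t k) k = gplus t k.
Proof.
congr (_ + _); apply: eq_bigr => i _.
by rewrite mxE eqxx orbT opprK.
Qed.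

End LatticeVariation.

(** * The exchange relation: transport along variation maps, and inversion *)

Section ExchangeRelation.
Variables (n m : nat).
Implicit Types (t : seed n m) (k : 'I_n) (d : 'rV[int]_n) (s : 'S_n).
Implicit Types (C D : algType laurent) (P : 'M[int]_(n + m)).
Implicit Types g h : 'rV[int]_(n + m).

Definition exchange_morph t k C D (X : 'rV[int]_(n + m) -> C)
    (Y : 'rV[int]_(n + m) -> D) (f : D -> C) : Prop :=
  (forall i, i != lshift m k -> f (Y (fvec i)) = X (fvec i)) /\
  f (Y (fvec (lshift m k))) = X (gminus t k) + X (gplus t k).

(** The two forms agree on the basis vectors other than the $k$-th, so [torus_rep_ext] applies there
    with the identity matrix. *)
Lemma exchange_morph_fix t k C D (X : 'rV[int]_(n + m) -> C)
    (Y : 'rV[int]_(n + m) -> D) (f : {lrmorphism D -> C}) :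
  (Lmat t)^T = - Lmat t -> torus_rep (Lmat t) X -> torus_rep (Lmat (mut t k)) Y ->
  (forall i, i != lshift m k -> f (Y (fvec i)) = X (fvec i)) ->
  forall g, g 0 (lshift m k) = 0 -> f (Y g) = X g.
Proof.
move=> skL Xrep Yrep fX g g0; rewrite -[g in RHS]mulmx1.
apply: (torus_rep_ext (S := [pred i | i != lshift m k]) (Lmat_mut_skew k skL) skL
  (torus_rep_morph f Yrep) Xrep).
- move=> i j ik jk; rewrite trmx1 mulmx1 mul1mx mxE /fvec_mut.
  by rewrite (negPf ik) (negPf jk) bform_delta.
- by move=> i ik; rewrite mulmx1; apply: fX.
- by move=> i; rewrite !inE negbK => /eqP ->.
Qed.

Lemma exchange_morph_transport d d' s t t' k P (C C' D D' : algType laurent)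
    (X : 'rV[int]_(n + m) -> C) (X' : 'rV[int]_(n + m) -> C')
    (Y : 'rV[int]_(n + m) -> D) (Y' : 'rV[int]_(n + m) -> D')
    (f : {lrmorphism D -> C}) (f' : {lrmorphism D' -> C'})
    (var : {lrmorphism C -> C'}) (var' : {lrmorphism D -> D'}) :
  compatible d t -> compatible d' t' -> Defs.similar s t t' ->
  lattice_variation s t t' P ->
  torus_rep (Lmat t) X -> torus_rep (Lmat t') X' ->
  torus_rep (Lmat (mut t k)) Y -> torus_rep (Lmat (mut t' (s k))) Y' ->
  (forall g, var (X g) = X' (g *m P)) ->
  (forall g, var' (Y g) = Y' (g *m (mut_mx t k *m P *m mut_mx t' (s k)))) ->
  (forall x, f' (var' x) = var (f x)) ->
  exchange_morph t k X Y f -> exchange_morph t' (s k) X' Y' f'.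
Proof.
move=> ct ct' sim vP Xrep Xrep' Yrep Yrep' varX var'X f'E [fX fXk].
have [skL _ _] := ct; have [skL' _ _] := ct'.
have [Pu _ _ _ Py] := vP.
have fr0 := frozen_lshift _ (s k).
have fvec0 i : i != lshift m (s k) -> (fvec i : 'rV[int]_(n + m)) 0 (lshift m (s k)) = 0.
  by move=> isk; rewrite fvecE eq_sym (negPf isk).
(* Pulled back by [P], the exponent $f_i$ has no $f_k$-component, so [f] is already known on its
   monomial. *)
have f'X i : i != lshift m (s k) -> f' (Y' (fvec i)) = X' (fvec i).
  move=> isk; have hk : (fvec i *m invmx P) 0 (lshift m k) = 0.
    by rewrite -(lattice_variation_lshift _ _ vP) (mulmxKV Pu) fvec0.
  have E : fvec i = fvec i *m invmx P *m (mut_mx t k *m P *m mut_mx t' (s k)).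
    by rewrite !mulmxA (mul_mut_mx_fix t hk) (mulmxKV Pu) mul_mut_mx_fix ?fvec0.
  rewrite [in LHS]E -var'X f'E (exchange_morph_fix skL Xrep Yrep fX hk) varX.
  by rewrite (mulmxKV Pu).
split=> //.
have [u uE] := lattice_variation_gminus k ct ct' sim vP.
set r := row_mx 0 u in uE; set z := fvec (lshift m (s k)).
have zE : z *m mut_mx t' (s k) = gminus t' (s k).
  by rewrite fvec_mut_mx /fvec_mut eqxx.
have rE : - r *m mut_mx t' (s k) = - r.
  by rewrite mul_mut_mx_fix // mxE fr0 oppr0.
have rzE : r + z = fvec (lshift m k) *m (mut_mx t k *m P *m mut_mx t' (s k)).
  rewrite !mulmxA fvec_mut_mx /fvec_mut eqxx uE mulmxDl -zE -mulmxA.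
  by rewrite (mut_mxK _ ct') mulmx1 mul_mut_mx_fix ?fr0.
have varD a b : var (a + b) = var a + var b := rmorphD var a b.
have f'M a b : f' (a * b) = f' a * f' b := rmorphM f' a b.
have f'rz : f' (Y' (r + z)) = X' (r + gminus t' (s k)) + X' (r + gplus t' (s k)).
  rewrite rzE -var'X f'E fXk varD !varX uE; congr (_ + X' _).
  by rewrite !gplusE addrA mulmxDl uE Py.
have [_ YM] := Yrep'; have [_ XM] := Xrep'.
have key : f' (Y' (- r) * Y' (r + z)) =
    vpow (bform (Lmat (mut t' (s k))) (- r) (r + z)) *: f' (Y' z).
  by rewrite YM addKr (linearZ_LR f').
have bE : bform (Lmat (mut t' (s k))) (- r) (r + z) =
    bform (Lmat t') (- r) (r + gminus t' (s k)).
  by rewrite Lmat_mut bform_conj rE mulmxDl zE mul_mut_mx_fix ?fr0.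
(* The two terms acquire the same power of $v$, since their exponents differ by a $y$-vector, which
   pairs to zero with frozen exponents. *)
have bE' : bform (Lmat t') (- r) (r + gplus t' (s k)) =
    bform (Lmat t') (- r) (r + gminus t' (s k)).
  rewrite gplusE addrA [LHS]bformDr (bform_skew (- r) (yvec _ _)) //.
  by rewrite (bform_yvec _ _ ct') mxE fr0 oppr0 mulr0 oppr0 addr0.
apply: (@vpow_scaleI C' (bform (Lmat t') (- r) (r + gminus t' (s k)))).
rewrite -bE -key f'M f'rz bE.
rewrite (exchange_morph_fix skL' Xrep' Yrep' f'X); last by rewrite mxE fr0 oppr0.
by rewrite mulrDr !XM !addKr bE' -scalerDr.
Qed.

Lemma exchange_morph_inv d t k C D (X : 'rV[int]_(n + m) -> C)
    (Y : 'rV[int]_(n + m) -> D) (f : {lrmorphism D -> C}) :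
  compatible d t -> torus_rep (Lmat t) X -> torus_rep (Lmat (mut t k)) Y ->
  injective ( *%R (f (Y (fvec (lshift m k))))) -> exchange_morph t k X Y f ->
  f (Y (gminus (mut t k) k)) + f (Y (gplus (mut t k) k)) = X (fvec (lshift m k)).
Proof.
move=> ct Xrep Yrep fY_inj [fX fXk]; have [skL _ _] := ct.
pose z := fvec (lshift m k).
(* After multiplying by the image of [X'_k], both sides are combinations of
   monomials whose exponents have no [f_k]-component. *)
apply: fY_inj; rewrite -/z.
have fix0 g : g 0 (lshift m k) = 0 -> f (Y g) = X g.
  exact: exchange_morph_fix skL Xrep Yrep fX _.
have [_ YM] := Yrep; have [_ XM] := Xrep.
have zz : z *m mut_mx t k = gminus t k by rewrite fvec_mut_mx /fvec_mut eqxx.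
have zz0 : bform (Lmat (mut t k)) z z = 0.
  by have := bform_skew z z (Lmat_mut_skew k skL); lia.
have qq0 : bform (Lmat t) (gminus t k) (gminus t k) = 0.
  by have := bform_skew (gminus t k) (gminus t k) skL; lia.
have fM a b : f (a * b) = f a * f b := rmorphM f a b.
have fZ a b : f (a *: b) = a *: f b := linearZ_LR f a b.
have fY g : (z + g) 0 (lshift m k) = 0 ->
    f (Y z) * f (Y g) = vpow (bform (Lmat t) (gminus t k) (z + g)) *: X (z + g).
  move=> zg; rewrite -fM YM fZ fix0 //; congr (vpow _ *: _).
  transitivity (bform (Lmat (mut t k)) z (z + g)); first by rewrite bformDr zz0 add0r.
  by rewrite Lmat_mut bform_conj zz mul_mut_mx_fix.
have zm : (z + gminus t k) 0 (lshift m k) = 0.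
  rewrite mxE gminusE fvecE (compatible_diag _ ct) oppr0 /posp maxxx eqxx.
  by lia.
have zp : (z + gplus t k) 0 (lshift m k) = 0.
  by rewrite gplusE addrA mxE zm yvecE (compatible_diag _ ct).
rewrite mulrDr gplus_mut gminus_mut !fY // [f (Y z)]fXk mulrDl !XM.
rewrite addrC ![_ + z]addrC gplusE; congr (vpow _ *: _ + vpow _ *: _).
  by rewrite bformDr qq0 addr0.
(* Both powers of $v$ exceed $\lambda(g,f_k)$, with $g$ = [gminus t k], by $d'_k$: the vector $y_k$
   pairs to $d'_k$ with $f_k$ and to $-d'_k$ with $g$. *)
rewrite (bformDr _ _ z) (bformDr _ _ (gminus t k)) (bformDl _ (gminus t k)) qq0.
rewrite (bform_skew (gminus t k) (yvec _ _)) //.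
rewrite !(bform_yvec _ _ ct) gminusE fvecE (compatible_diag _ ct) oppr0 /posp.
by rewrite maxxx eqxx; lia.
Qed.

End ExchangeRelation.

(** * Variation maps and mutations of skew-fields *)

Section FractionMonomials.
Variables (n m : nat) (F : forall t : seed n m, skew_frac (LP t)).
Implicit Types (t : seed n m) (k j : 'I_n) (d : 'rV[int]_n) (s : 'S_n).
Implicit Types (g h : 'rV[int]_(n + m)) (P : 'M[int]_(n + m)).

Definition fmon t g : F t := to_frac (F t) (Xmon t g).

Lemma fmon_rep t : torus_rep (Lmat t) (@fmon t).
Proof.
split=> [|g h]; first exact: (rmorph1 (to_frac (F t))).
rewrite /fmon -(rmorphM (to_frac (F t))) /Xmon qmonM.
exact: (linearZ_LR (to_frac (F t))).
Qed.

Lemma morph_fmon_rep t (D : algType laurent) (f : {lrmorphism F t -> D}) :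
  torus_rep (Lmat t) (fun g => f (fmon t g)).
Proof. exact: torus_rep_morph (fmon_rep t). Qed.

Lemma fmon_inj t : injective (@fmon t).
Proof. by move=> g h /(@to_frac_inj _ _ (F t))/(@qmon_inj _ (Lmat t)). Qed.

Lemma fmon_neq0 t g : fmon t g != 0.
Proof. by rewrite (to_frac_eq0 (F t)) (qmon_neq0 (Lmat t)). Qed.

Lemma fmon_scale_inj t a b g :
  vpow a *: fmon t g = vpow b *: fmon t g -> a = b.
Proof.
rewrite /fmon -!(linearZ_LR (to_frac (F t))) => /(@to_frac_inj _ _ (F t)).
exact: (@qmon_scale_inj _ (Lmat t)).
Qed.

(** Every variable goes to a monomial, whose exponent is a row of [P]. The commutation relations
    force [P] to preserve the form, and injectivity of [fmon] turns the remaining conditions into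
    statements on exponents. *)
Lemma variation_map_lattice s t t' (f : {lrmorphism F t -> F t'}) :
  (Lmat t)^T = - Lmat t -> (Lmat t')^T = - Lmat t' -> variation_map s f ->
  exists2 P, lattice_variation s t t' P &
    forall g, f (fmon t g) = fmon t' (g *m P).
Proof.
move=> skL skL' [f_bij fX fY fP].
have fXk k : exists u : 'rV[int]_m,
    f (fmon t (fvec (lshift m k))) = fmon t' (row_mx 0 u + fvec (lshift m (s k))).
  have [p [u ->] ->] := fX k; exists u.
  by rewrite /Xvar /Xmon cdot_qmon.
have fXf (u : 'rV[int]_m) : exists v : 'rV[int]_m,
    f (fmon t (row_mx 0 u)) = fmon t' (row_mx 0 v).
  have [p' [v ->] E] : exists2 p : LP t', frozen_factor p &
      f (fmon t (row_mx 0 u)) = to_frac (F t') p.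
    by apply/fP; exists (Xmon t (row_mx 0 u)) => //; exists u.
  by exists v.
have fXi i : exists p, f (fmon t (fvec i)) = fmon t' p.
  case: (split_ordP i) => [k ->|k ->].
    by have [u ->] := fXk k; exists (row_mx 0 u + fvec (lshift m (s k))).
  by rewrite fvec_rshift; have [v ->] := fXf (delta_mx 0 k); exists (row_mx 0 v).
have [p pE] := fin_all_exists fXi.
pose P : 'M[int]_(n + m) := \matrix_i p i.
have fP_row i : fvec i *m P = p i by rewrite -rowE rowK.
have PL : P *m Lmat t' *m P^T = Lmat t.
  apply/matrixP => i j; rewrite -!bform_delta bform_conj -!/(fvec _) !fP_row.
  symmetry; apply: (torus_rep_bform skL skL' (morph_fmon_rep f) (fmon_rep t')).
  - exact: pE.
  - exact: pE.
  - exact: fmon_scale_inj.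
have fE g : f (fmon t g) = fmon t' (g *m P).
  apply: (torus_rep_ext (S := predT) skL skL' (morph_fmon_rep f) (fmon_rep t')) => //.
  - by move=> i j _ _; rewrite PL.
  - by move=> i _; rewrite -/(fvec i) fP_row pE.
exists P => //.
have Pk k : exists u : 'rV[int]_m,
    fvec (lshift m k) *m P = row_mx 0 u + fvec (lshift m (s k)).
  by have [u uE] := fXk k; exists u; apply: (@fmon_inj t'); rewrite -fE.
have Pfr h : (exists u : 'rV[int]_m, h = row_mx 0 u *m P) <->
             (exists u : 'rV[int]_m, h = row_mx 0 u).
  split=> [[u ->]|[u ->]].
    by have [v vE] := fXf u; exists v; apply: (@fmon_inj t'); rewrite -fE.
  have [|q [v ->] E] := (fP (fmon t' (row_mx 0 u))).2.
    by exists (Xmon t' (row_mx 0 u)) => //; exists u.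
  by exists v; apply: (@fmon_inj t'); rewrite -fE.
split=> //; last by move=> k; apply: (@fmon_inj t'); rewrite -fE; apply: fY.
have [Q QE] : exists Q : 'I_(n + m) -> 'rV[int]_(n + m), forall i, Q i *m P = fvec i.
  apply: (@fin_all_exists _ (fun=> 'rV[int]_(n + m)) (fun i q => q *m P = fvec i)) => i.
  case: (split_ordP i) => k ->; last first.
    have [|u uE] := (Pfr (fvec (rshift n k))).2.
      by exists (delta_mx 0 k); rewrite fvec_rshift.
    by exists (row_mx 0 u).
  have [u uE] := Pk ((s^-1)%g k); have [|v vE] := (Pfr (row_mx 0 u)).2.
    by exists u.
  exists (fvec (lshift m ((s^-1)%g k)) - row_mx 0 v).
  by rewrite mulmxBl uE -vE permKV addrC addKr.
have QP : (\matrix_i Q i) *m P = 1%:M.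
  by apply/row_matrixP => i; rewrite row_mul rowK QE row1.
by have [] := mulmx1_unit QP.
Qed.

(** [P] and its inverse induce inverse isomorphisms of quantum tori, which extend to the
    skew-fields. *)
Lemma lattice_variation_map s t t' P : lattice_variation s t t' P ->
  exists2 f : {lrmorphism F t -> F t'}, variation_map s f &
    forall g, f (fmon t g) = fmon t' (g *m P).
Proof.
move=> [Pu PL Pk Pfr Py].
have PL' : invmx P *m Lmat t *m (invmx P)^T = Lmat t'.
  apply/matrixP => i j; rewrite -!bform_delta bform_conj -PL bform_conj.
  by rewrite !mulmxKV.
have [f fE] := qtorus_map PL; have [h hE] := qtorus_map PL'.
have fK : cancel f h.
  apply: (@qtorus_morph_id _ _ (h \o f)%FUN) => g.
  by rewrite [LHS](congr1 h (fE g)) hE mulmxK.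
have hK : cancel h f.
  apply: (@qtorus_morph_id _ _ (f \o h)%FUN) => g.
  by rewrite [LHS](congr1 f (hE g)) fE mulmxKV.
have [Phi Phi_bij PhiE] := frac_isomorphism (F t) (F t') fK hK.
have Phi_mon g : Phi (fmon t g) = fmon t' (g *m P).
  by rewrite /fmon (PhiE (Xmon t g)) (fE g).
exists Phi => //; split=> //.
- move=> k; have [u uE] := Pk k; exists (Xmon t' (row_mx 0 u)); first by exists u.
  by rewrite /Xvar [in RHS]/Xmon cdot_qmon -uE; apply: Phi_mon.
- by move=> k; rewrite [LHS]Phi_mon Py.
move=> y; split=> [[_ [u ->] ->]|[_ [u ->] ->]].
  have [|v vE] := (Pfr (row_mx 0 u *m P)).1; first by exists u.
  exists (Xmon t' (row_mx 0 v)); first by exists v.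
  by rewrite -vE; apply: Phi_mon.
have [|v vE] := (Pfr (row_mx 0 u)).2; first by exists u.
exists (Xmon t (row_mx 0 v)); first by exists v.
by rewrite vE; apply/esym/Phi_mon.
Qed.

Lemma mutation_isoE t k (f : {lrmorphism F (mut t k) -> F t}) :
  mutation_iso f <->
  bijective f /\ exchange_morph t k (fmon t) (fmon (mut t k)) f.
Proof.
have E : to_frac (F t) (Xmon t (gminus t k) + Xmon t (gplus t k)) =
    fmon t (gminus t k) + fmon t (gplus t k).
  exact: (rmorphD (to_frac (F t))).
split=> [[f_bij fX fXk]|[f_bij [fX fXk]]].
  by split=> //; split=> //; rewrite -E.
by split=> //; rewrite E.
Qed.

End FractionMonomials.

(** * Moving a twist automorphism along a mutation sequence *)

Section TwistConjugation.
Variables (n m : nat) (F : forall t : seed n m, skew_frac (LP t)).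
Implicit Types (t : seed n m) (k j : 'I_n) (d : 'rV[int]_n) (s : 'S_n).
Implicit Types (g h : 'rV[int]_(n + m)) (P : 'M[int]_(n + m)).

Local Notation X := (@fmon n m F _).

Lemma mutation_step d d' s t t' k P (var : {lrmorphism F t -> F t'})
    (f : {lrmorphism F (mut t k) -> F t}) :
  compatible d t -> compatible d' t' -> Defs.similar s t t' ->
  lattice_variation s t t' P -> bijective var ->
  (forall g, var (X g) = X (g *m P)) -> mutation_iso f ->
  exists (var' : {lrmorphism F (mut t k) -> F (mut t' (s k))})
         (f' : {lrmorphism F (mut t' (s k)) -> F t'}),
    [/\ variation_map s var', mutation_iso f' & forall x, f' (var' x) = var (f x)].
Proof.
move=> ct ct' sim vP var_bij varX /mutation_isoE[f_bij fX].
have vP2 := lattice_variation_mut k ct ct' sim vP.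
have [var' vvar' var'X] := lattice_variation_map F vP2.
have [var'_bij _ _ _] := vvar'; have [w [wK wK']] := bij_lrmorphism var'_bij.
have [f' f'bij f'E] : exists2 f' : {lrmorphism F (mut t' (s k)) -> F t'},
    bijective f' & forall x, f' (var' x) = var (f x).
  (* Defining [f'] by conjugation makes the square commute at once; the exchange relation is then
     transported. *)
  exists (var \o f \o w)%FUN; last by move=> x; apply: congr1 (wK x).
  exact: bij_comp (bij_comp var_bij f_bij) (Bijective wK' wK).
exists var', f'; split; [exact: vvar' | | exact: f'E].
apply/mutation_isoE; split; first exact: f'bij.
exact: (exchange_morph_transport ct ct' sim vP (fmon_rep F _) (fmon_rep F _)
  (fmon_rep F _) (fmon_rep F _) varX var'X f'E fX).
Qed.

Lemma mutation_iso_inv d t k (f : {lrmorphism F (mut t k) -> F t})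
    (h : {lrmorphism F t -> F (mut t k)}) :
  compatible d t -> mutation_iso f -> cancel f h -> cancel h f ->
  mutation_seq (t := mut t k) h.
Proof.
move=> ct /mutation_isoE[f_bij fX] fK hK; pose u := mut t k.
have fE : f (X (gminus u k)) + f (X (gplus u k)) = X (fvec (lshift m k)).
  apply: (exchange_morph_inv ct (fmon_rep F t) (fmon_rep F u) _ fX).
  apply: mulrI; apply: frac_unit; rewrite (raddf_eq0 _ (can_inj fK)).
  exact: fmon_neq0.
have [fXi _] := fX.
(* The domain of [h] is [F t], whereas a mutation step needs [F (mut u k)]. The seed is generalized
   so that the equality [mutK] can be substituted in the types. *)
have step t1 (h1 : {lrmorphism F t1 -> F u}) : t1 = mut u k -> bijective h1 ->
    (forall i, i != lshift m k -> h1 (X (fvec i)) = X (fvec i)) ->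
    h1 (X (fvec (lshift m k))) = X (gminus u k) + X (gplus u k) -> mutation_seq (t := u) h1.
  move=> e; move: h1; rewrite {t1}e => h1 h1_bij h1X h1z.
  by apply: (mutation_seq_rcons (mutation_seq_nil F u)); apply/mutation_isoE; do !split.
apply: step; first by rewrite (mutK k ct).
- by exists f.
- by move=> i ik; apply: etrans (congr1 h (esym (fXi i ik))) (fK _).
- by apply: (can_inj fK); rewrite hK (rmorphD f) fE.
Qed.

Lemma mutation_seq_cat t t1 t2 (f : F t1 -> F t) (g : F t2 -> F t1) :
  mutation_seq f -> mutation_seq g -> mutation_seq (fun x => f (g x)).
Proof.
move=> fS; elim=> {t2 g} [|t2 k g g0 _ IH g0iso]; first exact: fS.
exact: mutation_seq_rcons IH g0iso.
Qed.

Lemma mutation_seq_compatible d t t1 (f : F t1 -> F t) :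
  compatible d t -> mutation_seq f -> compatible d t1.
Proof.
move=> ct; elim=> {t1 f} [|t1 k f g _ IH _]; first exact: ct.
exact: compatible_mut.
Qed.

Lemma mutation_seq_inv d t t1 (f : F t1 -> F t) :
  compatible d t -> mutation_seq f ->
  exists h : F t -> F t1, [/\ mutation_seq h, cancel f h & cancel h f].
Proof.
move=> ct; elim=> {t1 f} [|t1 k f g fS [h [hS fK hK]] gI].
  by exists id; split=> //; apply: mutation_seq_nil.
have [g_bij _ _] := gI; have [w [wK wK']] := bij_lrmorphism g_bij.
exists (fun x => w (h x)); split.
- apply: mutation_seq_cat hS.
  exact: mutation_iso_inv (mutation_seq_compatible ct fS) gI wK wK'.
- by move=> x; rewrite fK wK.
- by move=> x; rewrite wK' hK.
Qed.

(** A ladder of commuting squares is built one mutation at a time; similarity of the current end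
    seeds and the variation map between them are the induction invariant. *)
Lemma variation_map_mutation_seq d d' s t t1 t' (f : F t1 -> F t)
    (var : {lrmorphism F t -> F t'}) :
  compatible d t -> compatible d' t' -> Defs.similar s t t' ->
  variation_map s var -> mutation_seq f ->
  exists t1' (var' : {lrmorphism F t1 -> F t1'}) (f' : F t1' -> F t'),
    [/\ mutation_seq f', Defs.similar s t1 t1', variation_map s var'
      & forall x, f' (var' x) = var (f x)].
Proof.
move=> ct ct' sim vvar; elim=> {t1 f}
    [|t1 k f g fS [t1' [var1 [f1 [f1S sim1 vvar1 f1E]]]] gI].
  by exists t', var, id; split=> //; apply: mutation_seq_nil.
have c1 := mutation_seq_compatible ct fS.
have c1' := mutation_seq_compatible ct' f1S.
have [[skL _ _] [skL' _ _]] := (c1, c1').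
have [P vP var1X] := variation_map_lattice skL skL' vvar1.
have [var1_bij _ _ _] := vvar1.
have [var2 [g' [vvar2 g'I g'E]]] := mutation_step c1 c1' sim1 vP var1_bij var1X gI.
exists (mut t1' (s k)), var2, (fun x => f1 (g' x)); split.
- exact: mutation_seq_rcons f1S g'I.
- exact: similar_mut c1 c1' sim1.
- exact: vvar2.
- by move=> x; apply: etrans (congr1 f1 (g'E x)) (f1E _).
Qed.

Lemma reachable_compatible d (t0 t : seed n m) :
  compatible d t0 -> reachable t0 t -> compatible d t.
Proof.
move=> c0 [ks ->]; elim: ks t0 c0 => //= k ks IH t0 c0.
exact/IH/compatible_mut.
Qed.

End TwistConjugation.

Theorem theorem5p1p7 (n m : nat) (F : forall t : seed n m, skew_frac (LP t))
    (t0 t s : seed n m) (tw : F t -> F t)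
    (mu_st : F s -> F t) (mu_st_inv : F t -> F s) :
  quantum_seed t0 -> reachable t0 t ->
  twist_automorphism tw ->
  mutation_seq mu_st -> cancel mu_st mu_st_inv -> cancel mu_st_inv mu_st ->
  twist_automorphism (fun x : F s => mu_st_inv (tw (mu_st x))).
Proof.
move=> /quantum_seed_compatible[d c0] t0t [t' [mu [sg [var [muS sim vvar twE]]]]].
move=> fS fK hK; have ct := reachable_compatible c0 t0t.
have ct' := mutation_seq_compatible ct muS.
have [h [hS fhK hfK]] := mutation_seq_inv ct fS.
have [s' [var' [f' [f'S sim' vvar' f'E]]]] :=
  variation_map_mutation_seq ct ct' sim vvar fS.
exists s', (fun x => h (mu (f' x))), sg, var'; split=> //.
  exact: mutation_seq_cat hS (mutation_seq_cat muS f'S).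
(* The given inverse [mu_st_inv] coincides with [h], which is known to come from a mutation
   sequence. *)
by move=> x; rewrite twE f'E -[LHS]fhK hK.
Qed.
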